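(* Let $(R,q)$ be a non-singular $2m$-dimensional quadratic space of plus type over $\mathbb{F}_2$. Let $\mathcal{S}$ be a maximal totally singular subspace of $(R^3,q^3)$ such that $w^3(v)\ge 4$ for all $v\in\mathcal{S}\setminus\{0\}$. Then $\mathcal{S}$ is conjugate under $O(R,q)^3$ to $\mathcal{S}(\Phi,\Psi;3)$ for some maximal totally singular subspaces $\Phi$ and $\Psi$ of $(R,q)$ satisfying $\Phi\cap\Psi=0$. Moreover, $O(R,q)^3$ is transitive on the set of all maximal totally singular subspaces $\mathcal{S}$ of $(R^3,q^3)$ satisfying $w^3(v)\ge 4$ for all $v\in\mathcal{S}\setminus\{0\}$.
   Context: A quadratic form on an $\mathbb{F}_2$-vector space $R$ is a map $q:R\to\mathbb{F}_2$ such that $\langle a,b\rangle=q(a+b)+q(a)+q(b)$ is a symmetric bilinear form with $\langle a,a\rangle=0$; it is non-singular if $\langle\ ,\ \rangle$ is non-degenerate. A subspace is totally singular if $q$ vanishes on it. A non-singular $q$ on a $2m$-dimensional space is of plus type if maximal totally singular subspaces have dimension $m$. $O(R,q)$ is the subgroup of $\mathrm{GL}(R)$ preserving $q$. $(R^3,q^3)$ is the orthogonal direct sum of three copies of $(R,q)$, with $q^3(a_1,a_2,a_3)=\sum_i q(a_i)$. Define $w:R\to\{0,1,2\}$ by $w(0)=0$, $w(a)=1$ if $q(a)=1$, $w(a)=2$ if $q(a)=0$ and $a\ne0$, and $w^3(a_1,a_2,a_3)=\sum_{i=1}^3 w(a_i)$. $O(R,q)^3=O(R,q)\times O(R,q)\times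 O(R,q)$ acts coordinatewise on $R^3$. For maximal totally singular subspaces $\Phi,\Psi$ of $R$, $$\mathcal{S}(\Phi,\Psi;3)=\{(a_1+b,a_2+b,a_3+b)\in R^3\mid a_i\in\Phi,\ b\in\Psi,\ a_1+a_2+a_3\in\Phi\cap\Psi\}.$$ *)

(* Defs.v *)
From HB Require Import structures.
From mathcomp Require Import all_boot all_order all_algebra.

Set Implicit Arguments.
Unset Strict Implicit.
Unset Printing Implicit Defensive.

Import GRing.Theory.
Local Open Scope ring_scope.

Section QuadraticSpaces.

Variable R : vectType 'F_2.
Implicit Types (q : R -> 'F_2) (U V : {vspace R}) (g : 'End(R)).

Definition polar q (a b : R) : 'F_2 := q (a + b) + q a + q b.

Definition quadratic_form q : Prop :=
  [/\ bilinear_for *%R *%R (polar q),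
      forall a b, polar q a b = polar q b a
    & forall a, polar q a a = 0].

Definition non_singular q : Prop :=
  forall a, (forall b, polar q a b = 0) -> a = 0.

Definition totally_singular q U : Prop := forall a, a \in U -> q a = 0.

Definition max_totally_singular q U : Prop :=
  totally_singular q U /\
  forall V, totally_singular q V -> (U <= V)%VS -> V = U.

Definition plus_type q (m : nat) : Prop :=
  \dim {:R} = (2 * m)%N /\
  forall U, max_totally_singular q U -> \dim U = m.

(* Membership in O(R,q); for an endomorphism of a finite dimensional space,
   a zero kernel means being in GL(R). *)
Definition orthogonal q g : Prop :=
  lker g = 0%VS /\ forall a, q (g a) = q a.

Definition weight q (a : R) : nat :=
  if a == 0 then 0%N else if q a == 1 then 1%N else 2%N.

End QuadraticSpaces.

Section Cube.

Variable R : vectType 'F_2.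
Implicit Types (q : R -> 'F_2) (v : {ffun 'I_3 -> R}).

Definition cube_form q v : 'F_2 := \sum_(i < 3) q (v i).

Definition cube_weight q v : nat := (\sum_(i < 3) weight q (v i))%N.

Definition cube_act (g : 'I_3 -> 'End(R)) v : {ffun 'I_3 -> R} :=
  [ffun i => g i (v i)].

(* B is the image of A under some g in O(R,q)^3; as g acts bijectively,
   B = g A means that v is in A if and only if g v is in B. *)
Definition cube_conjugate q (A B : {ffun 'I_3 -> R} -> Prop) : Prop :=
  exists g : 'I_3 -> 'End(R),
    (forall i, orthogonal q (g i)) /\ forall v, A v <-> B (cube_act g v).

Definition cube_code (Phi Psi : {vspace R}) v : Prop :=
  exists (a : 'I_3 -> R) (b : R),
    [/\ forall i, a i \in Phi,
        b \in Psi,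
        \sum_(i < 3) a i \in (Phi :&: Psi)%VS
      & v = [ffun i => a i + b]].

Definition max_singular_weight4 q (S : {vspace {ffun 'I_3 -> R}}) : Prop :=
  max_totally_singular (cube_form q) S /\
  forall v, v \in S -> v != 0 -> (4 <= cube_weight q v)%N.

End Cube.

(* Main.v *)
(* A maximal totally singular subspace S of R^3 equals its own orthogonal
   complement. The weight condition says that S meets each coordinate axis
   trivially and that a vector of S with a zero entry has singular entries, so
   the vectors (x, y, 0) of S project injectively to a totally singular subspace
   of R; a dimension count makes this projection self-orthogonal, and
   orthogonality of (x, y, 0) and (x', 0, z') shows that it depends only on the
   coordinate. By Witt's extension theorem we may move S by O(R,q)^3 so that
   (a,a,0) and (a,0,a) lie in S for all a in a fixed Phi. Orthogonality to these
   vectors forces v_i + v_j in Phi for v in S, and adding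
   (v_1+v_2, v_0+v_2, v_0+v_1) to v gives a diagonal vector of S; the diagonal
   of S is therefore the required complement Psi. Transitivity follows since any
   two pairs of complementary Lagrangians have hyperbolic bases. *)
From HB Require Import structures.
From mathcomp Require Import all_boot all_order all_algebra.
From mathcomp Require Import zify.
From Stdlib Require Import Classical.
Require Import Defs.

Set Implicit Arguments.
Unset Strict Implicit.
Unset Printing Implicit Defensive.

Import GRing.Theory.
Local Open Scope ring_scope.

(** * Arithmetic in characteristic two *)

Lemma pchar_F2 : 2%N \in [pchar 'F_2].
Proof. exact: pchar_Fp. Qed.

Lemma addvv2 (V : lmodType 'F_2) (x : V) : x + x = 0.
Proof. by rewrite -mulr2n -scaler_nat (pcharf0 pchar_F2) scale0r. Qed.

Lemma addFF2 (a : 'F_2) : a + a = 0.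
Proof. exact: addrr_pchar2 pchar_F2 a. Qed.

Lemma oppv2 (V : lmodType 'F_2) (x : V) : - x = x.
Proof. by apply/eqP; rewrite eq_sym -addr_eq0 addvv2. Qed.

Lemma F2_cases (a : 'F_2) : a = 0 \/ a = 1.
Proof. by case: a => -[|[|//]] ?; [left | right]; apply/val_inj. Qed.

Lemma linfun_linear (K : fieldType) (aT rT : vectType K) (f : aT -> rT) :
  linear f -> linfun f =1 f.
Proof.
move=> f_lin; pose L := GRing.isLinear.Build K aT rT *:%R f f_lin.
pose F : {linear aT -> rT} := HB.pack f L.
exact: (lfunE F).
Qed.

Lemma dim_ffun (K : fieldType) (I : finType) (V : vectType K) :
  \dim {:{ffun I -> V}} = (#|I| * \dim {:V})%N.
Proof. by rewrite !dimvf. Qed.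

(** * Lagrangian subspaces and hyperbolic bases *)

Section QuadraticSpace.

Variables (V : vectType 'F_2) (q : V -> 'F_2).
Hypothesis q_quad : quadratic_form q.
Implicit Types (U W : {vspace V}) (x y z : V).
Local Notation B := (polar q).

Lemma polarC x y : B x y = B y x.
Proof. by case: q_quad. Qed.

Lemma polarxx x : B x x = 0.
Proof. by case: q_quad. Qed.

Lemma polar_linearl y : scalar (B^~ y).
Proof. by case: q_quad => -[]. Qed.

Lemma polarDl x y z : B (x + y) z = B x z + B y z.
Proof. by have := polar_linearl z 1 x y; rewrite scale1r mul1r. Qed.

Lemma polar0l y : B 0 y = 0.
Proof. by have := polarDl 0 0 y; rewrite addr0 addFF2. Qed.

Lemma polarZl a x y : B (a *: x) y = a * B x y.
Proof. by have := polar_linearl y a x 0; rewrite addr0 polar0l addr0. Qed.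

Lemma polarDr x y z : B x (y + z) = B x y + B x z.
Proof. by rewrite polarC polarDl !(polarC x). Qed.

Lemma polar0r x : B x 0 = 0.
Proof. by rewrite polarC polar0l. Qed.

Lemma polarZr a x y : B x (a *: y) = a * B x y.
Proof. by rewrite polarC polarZl polarC. Qed.

Lemma polar_suml (I : Type) (r : seq I) (P : pred I) (F : I -> V) y :
  B (\sum_(i <- r | P i) F i) y = \sum_(i <- r | P i) B (F i) y.
Proof.
by apply: (big_morph (B^~ y)) => [x z|]; rewrite ?polarDl ?polar0l.
Qed.

Lemma polar_sumr (I : Type) (r : seq I) (P : pred I) (F : I -> V) x :
  B x (\sum_(i <- r | P i) F i) = \sum_(i <- r | P i) B x (F i).
Proof. by rewrite polarC polar_suml; apply: eq_bigr => i _; apply: polarC. Qed.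

Lemma quadD x y : q (x + y) = q x + q y + B x y.
Proof.
by rewrite /polar -[q (x + y) + _ + _]addrA [RHS]addrC -[RHS]addrA addFF2 addr0.
Qed.

Lemma quad0 : q 0 = 0.
Proof. by have := polarxx 0; rewrite /polar addr0 addFF2 add0r. Qed.

Lemma quadZ a x : q (a *: x) = a * q x.
Proof.
by case: (F2_cases a) => ->; rewrite ?scale0r ?scale1r ?mul0r ?mul1r ?quad0.
Qed.

Lemma quad_sum_isotropic (I : finType) (v : I -> V) (c : I -> 'F_2) :
  (forall i, q (v i) = 0) -> (forall i j, B (v i) (v j) = 0) ->
  q (\sum_i c i *: v i) = 0.
Proof.
move=> qv0 Bv0; elim: (index_enum I) => [|i r IHr].
  by rewrite big_nil quad0.
rewrite big_cons quadD quadZ qv0 IHr mulr0 !add0r polar_sumr big1 // => j _.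
by rewrite polarZl polarZr Bv0 !mulr0.
Qed.

Lemma polar_singular U x y :
  totally_singular q U -> x \in U -> y \in U -> B x y = 0.
Proof. by move=> U0 Ux Uy; rewrite /polar !U0 ?rpredD // !addr0. Qed.

(** Self-orthogonality replaces maximality as the working notion: membership in [U] can then be
    proved by testing orthogonality against [U]. *)
Definition lagrangian U : Prop :=
  totally_singular q U /\
  forall x, (forall y, y \in U -> B x y = 0) -> x \in U.

Lemma lagrangian_max U : lagrangian U -> max_totally_singular q U.
Proof.
case=> U0 perpU; split=> // W W0 sUW; apply/eqP; rewrite eqEsubv sUW andbT.
by apply/subvP=> x Wx; apply: perpU => y Uy;
  apply: (polar_singular W0) => //; apply: subvP Uy.
Qed.

Definition gram n (u : 'I_n -> V) : 'Hom(V, 'rV['F_2]_n) :=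
  linfun (fun x => \row_i B x (u i)).

Lemma gramE n (u : 'I_n -> V) x i : gram u x 0 i = B x (u i).
Proof.
rewrite linfun_linear ?mxE // => a y z; apply/rowP=> j.
by rewrite !mxE polarDl polarZl.
Qed.

Definition perp U : {vspace V} := lker (gram (tnth (vbasis U))).

Lemma perpP U x : reflect (forall y, y \in U -> B x y = 0) (x \in perp U).
Proof.
rewrite memv_ker; apply: (iffP eqP) => [x0 y Uy | x0].
  rewrite (coord_vbasis Uy) polar_sumr big1 // => i _.
  by rewrite -tnth_nth polarZr -gramE x0 mxE mulr0.
by apply/rowP=> i; rewrite gramE mxE x0 // vbasis_mem // mem_tnth.
Qed.

(** The Gram map against a basis of [W] is injective on [U], and its target has dimension
    [\dim W]. *)
Lemma dim_separated U W :
  (forall x, x \in U -> (forall y, y \in W -> B x y = 0) -> x = 0) ->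
  (\dim U <= \dim W)%N.
Proof.
move=> sepU; rewrite -(limg_dim_eq (f := gram (tnth (vbasis W)))).
  by rewrite (leq_trans (dimvS (subvf _))) // dimvf [dim _]mul1n.
apply/eqP; rewrite -subv0; apply/subvP=> x /memv_capP[Ux /perpP x0].
by rewrite memv0; apply/eqP/sepU.
Qed.

(** A complement of [perp U] is separated by [U]. *)
Lemma dim_perp_ge U : (\dim {:V} <= \dim U + \dim (perp U))%N.
Proof.
rewrite addnC -leq_subLR -dimv_compl.
apply: dim_separated => x; set C := (_^C)%VS => Cx /perpP Px.
by apply/eqP; rewrite -memv0 -(capv_compl (perp U)) memv_cap Px.
Qed.

(** [perp U] is separated by a complement of [U], since a vector orthogonal to both lies in the
    radical. *)
Lemma dim_perp_le U : non_singular q -> (\dim U + \dim (perp U) <= \dim {:V})%N.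
Proof.
move=> ns.
rewrite addnC -[X in (_ <= X)%N](subnK (dimvS (subvf U))) leq_add2r -dimv_compl.
apply: dim_separated => x /perpP Ux Cx; apply: ns => z.
have /memv_addP[y Uy [y' Cy' ->]]: z \in (U + U^C)%VS.
  by rewrite addv_complf memvf.
by rewrite polarDr Ux // Cx // addr0.
Qed.

Lemma singular_sub_perp U : totally_singular q U -> (U <= perp U)%VS.
Proof.
move=> U0; apply/subvP=> x Ux; apply/perpP=> y Uy; exact: (polar_singular U0).
Qed.

(** By maximality [U] absorbs the part of [W] orthogonal to it, so that part lies in [U :&: W]. The
    rest of [W] is separated by a complement of [U :&: W] in [U], because [U :&: W] is itself
    orthogonal to [W]. *)
Lemma dim_singular_le U W :
  max_totally_singular q U -> totally_singular q W -> (\dim W <= \dim U)%N.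
Proof.
move=> [U0 maxU] W0.
have sWU : (W :&: perp U <= U)%VS.
  apply/subvP=> x /memv_capP[Wx /perpP xU].
  have xx : x \in <[x]>%VS by apply: memv_line.
  suff <-: (U + <[x]>)%VS = U by rewrite (subvP (addvSr _ _)).
  apply: maxU (addvSl _ _) => _ /memv_addP[y Uy [_ /vlineP[a ->] ->]].
  by rewrite quadD U0 // quadZ W0 // polarC polarZl xU // !mulr0 !addr0.
rewrite -(dimv_cap_compl W (perp U)) -(dimv_cap_compl U W).
apply: leq_add; first by rewrite dimvS // subv_cap sWU capvSl.
apply: dim_separated => x Wx xU.
have /subvP/(_ _ Wx) Wx' := diffvSl W (perp U).
suff Px: x \in perp U.
  by apply/eqP; rewrite -memv0 -(capv_diff W (perp U)) memv_cap Wx.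
apply/perpP=> y; rewrite -(addv_diff_cap U W).
move=> /memv_addP[z Uz [z' /memv_capP[_ Wz'] ->]].
by rewrite polarDr xU // (polar_singular W0) // addr0.
Qed.

Hypothesis q_ns : non_singular q.

Lemma lagrangian_dim U : lagrangian U -> (\dim U + \dim U)%N = \dim {:V}.
Proof.
case=> U0 perpU; have /eqP perpE : perp U == U.
  by rewrite eqEsubv singular_sub_perp // andbT; apply/subvP=> x /perpP /perpU.
have le := dim_perp_le U q_ns; have ge := dim_perp_ge U.
by apply/eqP; move: le ge; rewrite perpE eqn_leq => -> ->.
Qed.

Lemma lagrangian_eq_dim U W : lagrangian U -> lagrangian W -> \dim U = \dim W.
Proof.
move=> lagU lagW; apply: double_inj; rewrite -!addnn.
by rewrite (lagrangian_dim lagU) (lagrangian_dim lagW).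
Qed.

Lemma singular_half_lagrangian U :
  totally_singular q U -> (\dim {:V} <= \dim U + \dim U)%N -> lagrangian U.
Proof.
move=> U0 dimU; split=> // x /perpP.
suff /eqP<-: U == perp U by [].
rewrite eqEdim singular_sub_perp //= -(leq_add2l (\dim U)).
exact: leq_trans (dim_perp_le _ q_ns) dimU.
Qed.

(** Once one Lagrangian exists, a maximal totally singular subspace has at least its dimension,
    which is half of the whole. *)
Lemma max_lagrangian U W :
  lagrangian W -> max_totally_singular q U -> lagrangian U.
Proof.
move=> lagW maxU; apply: singular_half_lagrangian; first by case: maxU.
have := dim_singular_le maxU (proj1 lagW).
by rewrite -(lagrangian_dim lagW) => le; apply: leq_add.
Qed.

(** The last clause makes [u] and [w] together a spanning family and gives the coordinates as
    pairings, so no separate basis is carried along. *)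
Definition hyperbolic n (u w : 'I_n -> V) : Prop :=
  [/\ forall i, q (u i) = 0 /\ q (w i) = 0,
      forall i j, B (u i) (u j) = 0 /\ B (w i) (w j) = 0,
      forall i j, B (u i) (w j) = (i == j)%:R
    & forall x, x = \sum_i B x (w i) *: u i + \sum_i B x (u i) *: w i].

Lemma hyperbolic_quad n (u w : 'I_n -> V) (c d : 'I_n -> 'F_2) :
  hyperbolic u w ->
  q (\sum_i c i *: u i + \sum_i d i *: w i) = \sum_i c i * d i.
Proof.
case=> q0 B0 Buw _.
rewrite quadD !quad_sum_isotropic;
  try by [move=> i; case: (q0 i) | move=> i j; case: (B0 i j)].
rewrite !add0r polar_suml; apply: eq_bigr => i _.
rewrite polar_sumr (bigD1 i) //= big1 => [|j /negPf ji].
  by rewrite polarZl polarZr Buw eqxx mulr1 addr0.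
by rewrite polarZl polarZr Buw eq_sym ji !mulr0.
Qed.

Lemma polar_preserved_injective (g : 'End(V)) :
  (forall x, q (g x) = q x) -> lker g = 0%VS.
Proof.
move=> gq; apply/eqP; rewrite -subv0; apply/subvP=> x; rewrite memv_ker memv0.
move=> /eqP gx0; apply/eqP/q_ns => y.
by have := polar0l (g y); rewrite -gx0 /polar -linearD !gq.
Qed.

Lemma orthogonal_polar (g : 'End(V)) x y :
  orthogonal q g -> B (g x) (g y) = B x y.
Proof. by case=> _ gq; rewrite /polar -linearD !gq. Qed.

Lemma hyperbolic_transport n (u w u' w' : 'I_n -> V) :
  hyperbolic u w -> hyperbolic u' w' ->
  exists g : 'End(V), orthogonal q g /\
    forall x, g x = \sum_i B x (w i) *: u' i + \sum_i B x (u i) *: w' i.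
Proof.
move=> hyp hyp'.
exists (linfun (fun x => \sum_i B x (w i) *: u' i + \sum_i B x (u i) *: w' i)).
set g := linfun _.
have gE x : g x = \sum_i B x (w i) *: u' i + \sum_i B x (u i) *: w' i.
  rewrite /g linfun_linear // => a y z.
  rewrite scalerDr addrACA; congr (_ + _); rewrite scaler_sumr -big_split /=;
  by apply: eq_bigr => i _; rewrite polarDl polarZl scalerDl scalerA.
have gq x : q (g x) = q x.
  rewrite gE (hyperbolic_quad _ _ hyp'); case: (hyp) => _ _ _ /(_ x) xE.
  by rewrite [in RHS]xE (hyperbolic_quad _ _ hyp).
by split=> //; split=> //; apply: polar_preserved_injective.
Qed.

(** The Gram map of [u] has kernel [U], as [U] is its own orthogonal complement. Since [U + W] is
    everything, its restriction to [W] is onto, and preimages of the unit rows form the dual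
    family. *)
Lemma dual_family n (u : n.-tuple V) U W :
  lagrangian U -> basis_of U u -> (U + W)%VS = fullv ->
  exists w : 'I_n -> V, forall j,
    w j \in W /\ forall i, B (tnth u i) (w j) = (i == j)%:R.
Proof.
move=> lagU basU UW; pose F := gram (tnth u).
have kerF : lker F = U.
  have [U0 perpU] := lagU; apply/vspaceP=> x; rewrite memv_ker.
  apply/eqP/idP=> [Fx0 | Ux]; last first.
    apply/rowP=> i; rewrite gramE mxE (polar_singular U0) //.
    exact: basis_mem basU (mem_tnth _ _).
  apply: perpU => y Uy; rewrite (coord_basis basU Uy) polar_sumr big1 // => i _.
  by rewrite -tnth_nth polarZr -gramE -/F Fx0 mxE mulr0.
have imF : (F @: W)%VS = fullv.
  have -> : (F @: W = F @: fullv)%VS.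
    have : (F @: U == 0)%VS by rewrite -lkerE kerF.
    by rewrite -UW limgD => /eqP->; rewrite add0v.
  (* Surjectivity of [F] by rank and nullity: both its kernel and its target have half the dimension
     of the space. *)
  apply/eqP; rewrite eqEdim subvf /= -(leq_add2l (\dim (fullv :&: lker F))).
  rewrite limg_ker_dim capfv kerF -(lagrangian_dim lagU) leq_add2l.
  by rewrite dimvf [dim _]mul1n (size_basis basU).
suff: forall j, exists w, w \in W /\ forall i, B (tnth u i) w = (i == j)%:R.
  exact: fin_all_exists.
move=> j; have : delta_mx 0 j \in (F @: W)%VS by rewrite imF memvf.
case/memv_imgP=> w Ww Fw; exists w; split=> // i.
by rewrite polarC -gramE -/F -Fw mxE eqxx.
Qed.

(** Only the expansion of [x] needs work. Its defect [d] is orthogonal to every [u i], hence lies in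
    [U]; its coordinates there are its pairings with the [w i], which also vanish. *)
Lemma hyperbolic_dual n (u : n.-tuple V) (w : 'I_n -> V) U :
  lagrangian U -> basis_of U u ->
  (forall i j, B (tnth u i) (w j) = (i == j)%:R) ->
  (forall i, q (w i) = 0) -> (forall i j, B (w i) (w j) = 0) ->
  hyperbolic (tnth u) w.
Proof.
move=> [U0 perpU] basU Buw qw Bw.
have Uu i : tnth u i \in U by apply: basis_mem basU (mem_tnth _ _).
split=> // [i|i j|x]; first by rewrite U0.
  by rewrite (polar_singular U0).
apply/eqP; rewrite -subr_eq0 oppv2; set d := x + _.
have du i : B d (tnth u i) = 0.
  rewrite !polarDl !polar_suml [X in _ + (X + _)]big1 ?add0r => [|j _];
    last first.
    by rewrite polarZl (polar_singular U0 (Uu j)) ?mulr0.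
  rewrite (bigD1 i) //= big1 => [|j /negPf ji].
    by rewrite polarZl polarC (polarC (w i)) Buw eqxx mulr1 addr0 addFF2.
  by rewrite polarZl (polarC (w j)) Buw eq_sym ji mulr0.
have dw i : B d (w i) = 0.
  rewrite !polarDl !polar_suml [X in _ + (_ + X)]big1 ?addr0 => [|j _];
    last first.
    by rewrite polarZl Bw mulr0.
  rewrite (bigD1 i) //= big1 => [|j /negPf ji].
    by rewrite polarZl Buw eqxx mulr1 addr0 addFF2.
  by rewrite polarZl Buw ji mulr0.
have Ud : d \in U.
  apply: perpU => y Uy; rewrite (coord_basis basU Uy) polar_sumr big1 // => i _.
  by rewrite -tnth_nth polarZr du mulr0.
rewrite (coord_basis basU Ud) big1 // => i _.
suff -> : coord u i d = 0 by rewrite scale0r.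
rewrite -(dw i) {2}(coord_basis basU Ud) polar_suml (bigD1 i) //= big1.
  by rewrite -tnth_nth polarZl Buw eqxx mulr1 addr0.
by move=> j /negPf ji; rewrite -tnth_nth polarZl Buw ji mulr0.
Qed.

(* Starting from any dual family [w], the corrections
   [w j + \sum_i c i j *: u i] stay dual to [u]; taking [c] upper triangular
   with [c i j = B (w i) (w j)] above the diagonal and [c j j = q (w j)]
   makes them isotropic. *)
Lemma hyperbolic_extension n (u : n.-tuple V) U :
  lagrangian U -> basis_of U u -> exists w, hyperbolic (tnth u) w.
Proof.
move=> lagU basU; have [U0 _] := lagU.
have Uu i : tnth u i \in U by apply: basis_mem basU (mem_tnth _ _).
have [w wP] := dual_family lagU basU (addvf U).
have Buw i j : B (tnth u i) (w j) = (i == j)%:R by case: (wP j).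
pose c (i j : 'I_n) : 'F_2 :=
  if (i < j)%N then B (w i) (w j) else if i == j then q (w j) else 0.
pose t j := \sum_i c i j *: tnth u i.
have Ut j : t j \in U by apply: memv_suml => i _; apply: memvZ.
have Bwt i j : B (w i) (t j) = c i j.
  rewrite polar_sumr (bigD1 i) //= big1 => [|k /negPf ki].
    by rewrite polarZr polarC Buw eqxx mulr1 addr0.
  by rewrite polarZr polarC Buw ki mulr0.
exists (fun j => w j + t j); apply: (hyperbolic_dual lagU basU) => [i j|i|i j].
- by rewrite polarDr Buw (polar_singular U0) // addr0.
- by rewrite quadD (U0 _ (Ut i)) addr0 Bwt /c ltnn eqxx addFF2.
rewrite polarDl !polarDr (polar_singular U0 (Ut i) (Ut j)) addr0.
rewrite Bwt (polarC (t i)) Bwt.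
rewrite /c; case: ltngtP => [ij|ji|/val_inj->].
- by rewrite -val_eqE /= gtn_eqF // addr0 addFF2.
- by rewrite -val_eqE /= gtn_eqF // addr0 polarC addFF2.
by rewrite polarxx eqxx add0r addFF2.
Qed.

(** A dual family chosen inside the Lagrangian [W] is isotropic without correction. *)
Lemma hyperbolic_pair n (u : n.-tuple V) U W :
  lagrangian U -> lagrangian W -> (U :&: W)%VS = 0%VS -> basis_of U u ->
  exists2 w, hyperbolic (tnth u) w & forall i, w i \in W.
Proof.
move=> lagU lagW UW0 basU; have [W0 _] := lagW.
have UW : (U + W)%VS = fullv.
  apply/eqP; rewrite eqEdim subvf dimv_disjoint_sum //=.
  by rewrite (lagrangian_eq_dim lagW lagU) (lagrangian_dim lagU).
have [w wP] := dual_family lagU basU UW.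
have Ww i : w i \in W by case: (wP i).
exists w => //; apply: (hyperbolic_dual lagU basU) => [i j|i|i j].
- by case: (wP j).
- exact: W0.
exact: (polar_singular W0).
Qed.

(** If [g x] is in [W], it is orthogonal to the image of [U], so [x] is orthogonal to [U]. *)
Lemma orthogonal_mem_lagrangian (g : 'End(V)) U W x :
  orthogonal q g -> lagrangian U -> lagrangian W ->
  (forall y, y \in U -> g y \in W) -> (x \in U) = (g x \in W).
Proof.
move=> og [_ perpU] [W0 _] gUW; apply/idP/idP=> [/gUW //|Wgx].
apply: perpU => y Uy; rewrite -(orthogonal_polar _ _ og).
by apply: (polar_singular W0) => //; apply: gUW.
Qed.

Lemma lagrangian_pair_transport U W U' W' :
  lagrangian U -> lagrangian W -> (U :&: W)%VS = 0%VS ->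
  lagrangian U' -> lagrangian W' -> (U' :&: W')%VS = 0%VS ->
  exists g : 'End(V), [/\ orthogonal q g,
    forall x, (x \in U) = (g x \in U') & forall x, (x \in W) = (g x \in W')].
Proof.
move=> lagU lagW UW0 lagU' lagW' UW0'.
have [w hyp Ww] := hyperbolic_pair lagU lagW UW0 (vbasisP U).
have [u' basU'] : exists u' : (\dim U).-tuple V, basis_of U' u'.
  by rewrite (lagrangian_eq_dim lagU lagU'); exists (vbasis U'); apply: vbasisP.
have [w' hyp' Ww'] := hyperbolic_pair lagU' lagW' UW0' basU'.
have [g [og gE]] := hyperbolic_transport hyp hyp'.
exists g; split=> // x; apply: orthogonal_mem_lagrangian => // y Hy; rewrite gE.
(* On [U] the pairings with the basis of [U] vanish, so only the [u'] part survives; on [W] only the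
   [w'] part does. *)
- rewrite [X in _ + X]big1 ?addr0 => [|i _].
    by apply: memv_suml => i _; apply/memvZ/(basis_mem basU')/mem_tnth.
  rewrite (polar_singular (proj1 lagU)) ?scale0r //.
  exact: vbasis_mem (mem_tnth _ _).
rewrite big1 ?add0r => [|i _].
  by apply: memv_suml => i _; apply/memvZ/Ww'.
by rewrite (polar_singular (proj1 lagW)) ?scale0r.
Qed.

(* Witt's extension theorem for isometries between Lagrangian subspaces,
   parametrised by a common domain [K]. *)
Lemma lagrangian_extension (X : vectType 'F_2) (K : {vspace X})
    (f f' : 'Hom(X, V)) :
  (K :&: lker f)%VS = 0%VS -> (K :&: lker f')%VS = 0%VS ->
  lagrangian (f @: K) -> lagrangian (f' @: K) ->
  exists g : 'End(V), orthogonal q g /\ {in K, forall k, g (f k) = f' k}.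
Proof.
move=> kf kf' lagf lagf'.
(* One basis of [K] gives bases of both Lagrangians with matching indices. *)
have bas (h : 'Hom(X, V)) : (K :&: lker h)%VS = 0%VS ->
    basis_of (h @: K)%VS [tuple of map h (vbasis K)].
  by move=> /eqP kh; apply: limg_basis_of (vbasisP K); apply/eqP.
have [w hyp] := hyperbolic_extension lagf (bas _ kf).
have [w' hyp'] := hyperbolic_extension lagf' (bas _ kf').
have [g [og gE]] := hyperbolic_transport hyp hyp'.
exists g; split=> // k Kk; rewrite (coord_vbasis Kk) !linear_sum.
apply: eq_bigr => i _ /=; rewrite !linearZ /=; congr (_ *: _).
have [_ B0 Buw _] := hyp.
have := Buw i; have := B0 i; rewrite !tnth_map !(tnth_nth 0) => Bi0 Biw.
rewrite gE (bigD1 i) //= big1 => [|j /negPf ji].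
  rewrite Biw eqxx scale1r addr0 big1 ?addr0 => [|j _].
    by rewrite tnth_map (tnth_nth 0).
  by case: (Bi0 j) => -> _; rewrite scale0r.
by rewrite Biw eq_sym ji scale0r.
Qed.

End QuadraticSpace.

Lemma exists_max_totally_singular (V : vectType 'F_2) (q : V -> 'F_2) :
  quadratic_form q -> exists U, max_totally_singular q U.
Proof.
move=> q_quad.
(* Induction on a strict bound for the codimension, enlarging [U] as long as it is not maximal. *)
suff ext n : forall U, totally_singular q U -> (\dim {:V} - \dim U < n)%N ->
    exists W, max_totally_singular q W.
  apply: (ext _ 0%VS _ (leqnn _)) => x.
  by rewrite memv0 => /eqP->; apply: quad0.
elim: n => // n IHn U U0 codimU.
have [[W [W0 sUW neqWU]]|maxU] := classic
    (exists W, [/\ totally_singular q W, (U <= W)%VS & W != U]); last first.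
  exists U; split=> // W W0 sUW; apply/eqP/negPn/negP=> neqWU.
  by apply: maxU; exists W.
apply: (IHn W W0); rewrite -ltnS (leq_trans _ codimU) // ltnS ltn_sub2l //.
  rewrite (leq_trans _ (dimvS (subvf W))) //.
  by rewrite ltn_neqAle dimvS // andbT (dimv_leqif_eq sUW) eq_sym.
by rewrite ltn_neqAle dimvS // andbT (dimv_leqif_eq sUW) eq_sym.
Qed.

Lemma orthogonal_inv (V : vectType 'F_2) (q : V -> 'F_2) (g : 'End(V)) :
  quadratic_form q -> non_singular q -> orthogonal q g ->
  orthogonal q g^-1%VF /\ cancel g^-1%VF g /\ cancel g g^-1%VF.
Proof.
move=> q_quad q_ns [/eqP kg gq].
have gK := lker0_lfunK kg; have gVK := lker0_lfunVK kg.
have gVq x : q (g^-1%VF x) = q x by rewrite -{2}(gVK x) gq.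
by split=> //; split=> //; apply: (polar_preserved_injective q_quad q_ns).
Qed.

(** * The cube of a quadratic space *)

Local Notation i0 := (@Ordinal 3 0 isT).
Local Notation i1 := (@Ordinal 3 1 isT).
Local Notation i2 := (@Ordinal 3 2 isT).

Lemma ord3_forall (P : 'I_3 -> Prop) : P i0 -> P i1 -> P i2 -> forall i, P i.
Proof.
move=> P0 P1 P2; case=> -[|[|[|//]]] lt_i;
  by rewrite (bool_irrelevance lt_i isT).
Qed.

Lemma ord3_third (i k : 'I_3) : i != k -> exists j, uniq [:: i; j; k].
Proof.
elim/ord3_forall: i; elim/ord3_forall: k => // _;
  by [exists i0 | exists i1 | exists i2].
Qed.

(** The order of the three indices is free, so later arguments handle all choices of coordinates at
    once. *)
Lemma big_ord3 (T : Type) (idx : T) (op : Monoid.com_law idx) (F : 'I_3 -> T)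
    (i j k : 'I_3) : uniq [:: i; j; k] ->
  \big[op/idx]_(l < 3) F l = op (F i) (op (F j) (F k)).
Proof.
move=> uijk; rewrite (bigD1 i) //= (bigD1 j) /=; last first.
  by move: uijk; rewrite /= !inE eq_sym; case: eqP.
congr (op _ (op _ _)); apply: big_pred1 => l; move: uijk.
elim/ord3_forall: i; elim/ord3_forall: j; elim/ord3_forall: k => //;
  by elim/ord3_forall: l.
Qed.

Section Cube.

Variables (R : vectType 'F_2) (q : R -> 'F_2).
Hypotheses (q_quad : quadratic_form q) (q_ns : non_singular q).
Local Notation R3 := {ffun 'I_3 -> R}.
Local Notation q3 := (cube_form q).
Local Notation B := (polar q).

Lemma sum3 (V : nmodType) (F : 'I_3 -> V) :
  \sum_(i < 3) F i = F i0 + F i1 + F i2.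
Proof. by rewrite (@big_ord3 _ _ _ F i0 i1 i2) //= addrA. Qed.

Lemma polar_cube (v w : R3) : polar q3 v w = \sum_(i < 3) B (v i) (w i).
Proof.
by rewrite /polar /cube_form -!big_split; apply: eq_bigr => i _; rewrite ffunE.
Qed.

Lemma cube_quadratic : quadratic_form q3.
Proof.
split=> [|v w|v].
- split=> w a u v; rewrite /= !polar_cube mulr_sumr -big_split /=.
    by apply: eq_bigr => i _; rewrite !ffunE polarDl // polarZl.
  by apply: eq_bigr => i _; rewrite !ffunE polarDr // polarZr.
- by rewrite !polar_cube; apply: eq_bigr => i _; apply: polarC.
by rewrite polar_cube big1 // => i _; apply: polarxx.
Qed.

Definition single (i : 'I_3) (x : R) : R3 :=
  [ffun j => if j == i then x else 0].

Lemma polar_single i x (w : R3) : polar q3 (single i x) w = B x (w i).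
Proof.
rewrite polar_cube (bigD1 i) //= big1 => [|j /negPf ji].
  by rewrite ffunE eqxx addr0.
by rewrite ffunE ji polar0l.
Qed.

Lemma cube_non_singular : non_singular q3.
Proof.
move=> v v0; apply/ffunP=> i; rewrite ffunE; apply: q_ns => x.
by rewrite (polarC q_quad) -polar_single (polarC cube_quadratic).
Qed.

Definition coordinate (i : 'I_3) : 'Hom(R3, R) := linfun (fun v : R3 => v i).

Lemma coordinateE i v : coordinate i v = v i.
Proof. by rewrite linfun_linear // => a u w; rewrite !ffunE. Qed.

Definition triple (a b c : R) : R3 :=
  [ffun i => if i == i0 then a else if i == i1 then b else c].

Lemma triple_eta (v : R3) : v = triple (v i0) (v i1) (v i2).
Proof. by apply/ffunP; elim/ord3_forall; rewrite ffunE. Qed.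

Lemma tripleD a b c a' b' c' :
  triple a b c + triple a' b' c' = triple (a + a') (b + b') (c + c').
Proof. by apply/ffunP; elim/ord3_forall; rewrite !ffunE. Qed.

Lemma polar_triple a b c v :
  polar q3 (triple a b c) v = B a (v i0) + B b (v i1) + B c (v i2).
Proof. by rewrite polar_cube sum3 !ffunE. Qed.

(** The witness is the cube of [U]. It serves to turn maximal totally singular subspaces of the cube
    into Lagrangians through [max_lagrangian]. *)
Lemma cube_lagrangian U : lagrangian q U -> exists W, lagrangian q3 W.
Proof.
case=> U0 perpU; pose W := (\bigcap_i (coordinate i @^-1: U))%VS.
have memW v : (v \in W) <-> forall i, v i \in U.
  split=> [Wv i | Uv].
    by rewrite -coordinateE memv_preim; move: v Wv; apply/subvP/bigcapv_inf.
  rewrite memvE; apply/subv_bigcapP=> i _.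
  by rewrite -memvE -memv_preim coordinateE.
exists W; split=> [v /memW Uv | v perpv].
  by rewrite /cube_form big1 // => i _; apply: U0.
apply/memW=> i; apply: perpU => x Ux.
rewrite (polarC q_quad) -polar_single (polarC cube_quadratic); apply: perpv.
by apply/memW=> j; rewrite ffunE; case: ifP; rewrite ?mem0v.
Qed.

(** * Subspaces of the cube in normal position *)

Section NormalForm.

Variables (S : {vspace R3}) (Phi : {vspace R}).
Hypotheses (lagS : lagrangian q3 S) (lagPhi : lagrangian q Phi).
Hypothesis S_aa0 : forall a, a \in Phi -> triple a a 0 \in S.
Hypothesis S_a0a : forall a, a \in Phi -> triple a 0 a \in S.
Hypothesis S_a00 : forall a, triple a 0 0 \in S -> a = 0.

(** Here [a = b + c], and the triple is $(b,b,0)+(c,0,c)$. *)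
Lemma sum0_triple_mem a b c :
  a \in Phi -> b \in Phi -> c \in Phi -> a + b + c = 0 -> triple a b c \in S.
Proof.
move=> Pa Pb Pc; rewrite -addrA => /eqP; rewrite addr_eq0 oppv2 => /eqP->.
have := rpredD (S_aa0 Pb) (S_a0a Pc).
by rewrite tripleD addr0 add0r.
Qed.

Lemma pairwise_sum_mem (v : R3) : v \in S ->
  [/\ v i1 + v i2 \in Phi, v i0 + v i2 \in Phi & v i0 + v i1 \in Phi].
Proof.
move=> Sv; have [S0 _] := lagS; have [_ perpPhi] := lagPhi.
have P01 : v i0 + v i1 \in Phi.
  apply: perpPhi => a Pa; rewrite (polarC q_quad) polarDr //.
  have := polar_singular S0 (S_aa0 Pa) Sv.
  by rewrite polar_triple polar0l // addr0.
have P02 : v i0 + v i2 \in Phi.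
  apply: perpPhi => a Pa; rewrite (polarC q_quad) polarDr //.
  have := polar_singular S0 (S_a0a Pa) Sv.
  by rewrite polar_triple polar0l // addr0.
by split=> //; have := rpredD P01 P02; rewrite addrACA addvv2 add0r.
Qed.

(* Adding [(v1 + v2, v0 + v2, v0 + v1)], which lies in [S] because its entries
   are in [Phi] and sum to zero, turns [v] into a diagonal vector. *)
Lemma diagonal_sum_mem (v : R3) (s := v i0 + v i1 + v i2) :
  v \in S -> triple s s s \in S.
Proof.
move=> Sv; have [P12 P02 P01] := pairwise_sum_mem Sv.
have sum0 : (v i1 + v i2) + (v i0 + v i2) + (v i0 + v i1) = 0.
  by rewrite [X in X + _]addrACA addvv2 addr0 [v i1 + _]addrC addvv2.
have := rpredD Sv (sum0_triple_mem P12 P02 P01 sum0).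
rewrite {1}(triple_eta v) tripleD /s.
by rewrite addrA (addrCA (v i1)) addrA (addrC (v i2)).
Qed.

Lemma normal_form : exists Psi : {vspace R},
  [/\ lagrangian q Psi, (Phi :&: Psi)%VS = 0%VS
    & forall v, v \in S <-> cube_code Phi Psi v].
Proof.
have [S0 perpS] := lagS.
pose Psi := (linfun (fun x => triple x x x) @^-1: S)%VS.
have memPsi x : (x \in Psi) = (triple x x x \in S).
  rewrite -memv_preim linfun_linear // => a y z.
  by apply/ffunP; elim/ord3_forall; rewrite !ffunE.
have PhiPsi x : x \in Phi -> x \in Psi -> x = 0.
  rewrite memPsi => Px Sx; apply: S_a00.
  (* Adding $(0,x,x)$ to $(x,x,x)$ leaves $(x,0,0)$ in [S]. *)
  have sum0 : 0 + x + x = 0 by rewrite add0r addvv2.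
  have := rpredD Sx (sum0_triple_mem (mem0v _) Px Px sum0).
  by rewrite tripleD addr0 !addvv2.
have capPhiPsi : (Phi :&: Psi)%VS = 0%VS.
  apply/eqP; rewrite -subv0; apply/subvP=> x /memv_capP[Px Qx].
  by rewrite memv0; apply/eqP/PhiPsi.
exists Psi; split=> // [|v].
  split=> [x|x perpx]; rewrite memPsi.
    by move/S0; rewrite /cube_form sum3 !ffunE /= addFF2 add0r.
  (* The pairing of $(x,x,x)$ with [v] is that of [x] with the sum of the entries of [v], which lies
     in [Psi]. *)
  apply: perpS => v /diagonal_sum_mem; rewrite -memPsi => /perpx.
  by rewrite polar_triple !polarDr.
split=> [Sv | [a [b [Pa Pb]]]].
  have [P12 P02 P01] := pairwise_sum_mem Sv; pose s := v i0 + v i1 + v i2.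
  have sE : s = \sum_(i < 3) v i by rewrite sum3.
  (* Each [v i + s] is the sum of the other two entries, hence in [Phi]; the three add up to
     $4s=0$. *)
  exists (fun i => v i + s), s; split; rewrite ?memPsi ?diagonal_sum_mem //.
  - elim/ord3_forall; rewrite /s /=.
    + by rewrite -addrA (addrA (v i0) (v i0)) addvv2 add0r.
    + by rewrite (addrAC (v i0)) (addrC (v i1)) -(addrA (v i0 + v i2)) addvv2
        addr0.
    by rewrite (addrC (v i2)) -(addrA (v i0 + v i1)) addvv2 addr0.
  - by rewrite big_split /= -sE sum3 addvv2 add0r addvv2 mem0v.
  by apply/ffunP=> i; rewrite ffunE -addrA addvv2 addr0.
rewrite capPhiPsi memv0 sum3 => /eqP sum0 ->.
suff -> : [ffun i => a i + b] = triple (a i0) (a i1) (a i2) + triple b b b.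
  by rewrite rpredD // -?memPsi // sum0_triple_mem.
by apply/ffunP; elim/ord3_forall; rewrite !ffunE.
Qed.

End NormalForm.

Lemma weight_le2 x : (weight q x <= 2)%N.
Proof. by rewrite /weight; case: ifP => // _; case: ifP. Qed.

(** * Vectors with a zero entry and their projections *)

Section Faces.

Variable S : {vspace R3}.
Hypothesis lagS : lagrangian q3 S.
Hypothesis weightS : forall v, v \in S -> v != 0 -> (4 <= cube_weight q v)%N.

Definition zero_section (k : 'I_3) : {vspace R3} := (S :&: lker (coordinate k))%VS.

Definition face (i k : 'I_3) : {vspace R} := (coordinate i @: zero_section k)%VS.

Lemma zero_sectionP k v : reflect (v \in S /\ v k = 0) (v \in zero_section k).
Proof.
by rewrite memv_cap memv_ker coordinateE; apply: (iffP andP) => -[Sv /eqP].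
Qed.

(** At most one entry of [v] would be nonzero, giving weight at most 2. *)
Lemma zero_section_coord_inj i k v :
  i != k -> v \in zero_section k -> v i = 0 -> v = 0.
Proof.
move=> /ord3_third[j uijk] /zero_sectionP[Sv vk0] vi0; apply/eqP/negPn/negP.
move/(weightS Sv); rewrite /cube_weight (big_ord3 _ _ uijk) vi0 vk0.
by rewrite /weight eqxx /= add0n addn0 leqNgt ltnS (leq_trans (weight_le2 _)).
Qed.

(** The two remaining entries have equal [q]-values because [v] is singular; if both were 1, the
    weight of [v] would be 2. *)
Lemma zero_section_coord_singular i k v : i != k -> v \in zero_section k -> q (v i) = 0.
Proof.
move=> /ord3_third[j uijk] /zero_sectionP[Sv vk0].
have [//|qvi] := F2_cases (q (v i)).
have := proj1 lagS v Sv; rewrite /cube_form (big_ord3 _ _ uijk) /= vk0.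
rewrite quad0 // addr0 qvi => /eqP.
rewrite addr_eq0 oppr_pchar2 ?pchar_F2 // => /eqP qvj.
have nz x : q x = 1 -> x != 0 by apply: contra_eq_neq => ->; rewrite quad0.
have /(weightS Sv) : v != 0.
  by apply: contraNneq (nz _ qvi) => ->; rewrite ffunE.
rewrite /cube_weight (big_ord3 _ _ uijk) /= vk0 /weight eqxx.
by rewrite (negPf (nz _ qvi)) (negPf (nz (v j) _)) // qvi -qvj.
Qed.

(** Projection to coordinate [i] preserves the dimension of the zero section. As [S] has dimension
    $\frac32\dim R$ and coordinate [k] has rank at most $\dim R$, that dimension is at least
    $\frac12\dim R$. *)
Lemma face_lagrangian i k : i != k -> lagrangian q (face i k).
Proof.
move=> ik; apply: (singular_half_lagrangian q_quad q_ns).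
  move=> _ /memv_imgP[v Kv ->]; rewrite coordinateE.
  exact: zero_section_coord_singular Kv.
rewrite limg_dim_eq; last first.
  apply/eqP; rewrite -subv0; apply/subvP=> v /memv_capP[Kv].
  by rewrite memv_ker coordinateE memv0 => /eqP/(zero_section_coord_inj ik Kv)->.
have dimS := lagrangian_dim cube_quadratic cube_non_singular lagS.
have := limg_ker_dim (coordinate k) S; rewrite -/(zero_section k) => dimK.
have dimI := dimvS (subvf (coordinate k @: S)%VS).
move: dimS; rewrite dim_ffun card_ord -dimK; lia.
Qed.

(** Vectors of [S] vanishing at [k] and at [j] respectively overlap only in coordinate [i], so their
    orthogonality there puts one face in the complement of the other. *)
Lemma face_sub i j k :
  uniq [:: i; j; k] -> (face i k <= face i j)%VS.
Proof.
move=> uijk; move: (uijk).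
rewrite /= !inE negb_or andbT => /andP[/andP[ij ik] jk].
have [_ perpF] := face_lagrangian ij.
apply/subvP=> _ /memv_imgP[v /zero_sectionP[Sv vk] ->]; apply: perpF.
move=> _ /memv_imgP[w /zero_sectionP[Sw wj] ->].
have := polar_singular (proj1 lagS) Sv Sw.
rewrite polar_cube (big_ord3 _ _ uijk) /= vk wj.
by rewrite polar0l ?polar0r ?addr0 ?coordinateE.
Qed.

Lemma face_eq i j k : uniq [:: i; j; k] -> face i j = face i k.
Proof.
move=> uijk; apply/eqP; rewrite eqEsubv (face_sub uijk) andbT face_sub //.
move: uijk; rewrite /= !inE !negb_or (eq_sym k j) !andbT.
by move=> /andP[/andP[-> ->] ->].
Qed.

(** Both projections of the zero section are injective with Lagrangian image, so sending [v j] to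
    [v i0] is a well-defined isometry of Lagrangians, and it extends to [R]. *)
Lemma face_isometry (j k : 'I_3) : j != i0 -> k != i0 -> j != k ->
  exists g : 'End(R), orthogonal q g /\
    {in zero_section k, forall v : R3, g (v j) = v i0}.
Proof.
move=> j0 k0 jk.
have inj i : i != k -> (zero_section k :&: lker (coordinate i))%VS = 0%VS.
  move=> ik; apply/eqP; rewrite -subv0; apply/subvP=> v /memv_capP[Kv].
  by rewrite memv_ker coordinateE memv0 => /eqP/(zero_section_coord_inj ik Kv)->.
have lag i : i != k -> lagrangian q (coordinate i @: zero_section k).
  exact: face_lagrangian.
have k0' : i0 != k by rewrite eq_sym.
have [g [og gP]] := lagrangian_extension q_quad q_ns (inj _ jk) (inj _ k0')
  (lag _ jk) (lag _ k0').
by exists g; split=> // v /gP; rewrite !coordinateE.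
Qed.

End Faces.

(** * The action of $O(R,q)^3$ on subspaces of the cube *)

Definition cube_map (g : 'I_3 -> 'End(R)) : 'End(R3) := linfun (cube_act g).

Lemma cube_mapE g v : cube_map g v = cube_act g v.
Proof.
by rewrite linfun_linear // => a u w; apply/ffunP=> i; rewrite !ffunE linearP.
Qed.

Section Action.

Variable g : 'I_3 -> 'End(R).
Hypothesis og : forall i, orthogonal q (g i).

Lemma cube_act_orthogonal : orthogonal q3 (cube_map g).
Proof.
have gq v : q3 (cube_map g v) = q3 v.
  rewrite cube_mapE; apply: eq_bigr => i _; rewrite ffunE.
  by case: (og i) => _ ->.
split=> //; exact: (polar_preserved_injective cube_quadratic cube_non_singular).
Qed.

Lemma cube_actVK : cancel (cube_act (fun i => (g i)^-1%VF)) (cube_act g).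
Proof.
move=> v; apply/ffunP=> i; rewrite !ffunE.
by have [_ []] := orthogonal_inv q_quad q_ns (og i).
Qed.

Lemma cube_map_mem S v : (cube_act g v \in (cube_map g @: S)%VS) = (v \in S).
Proof.
have /lker0P inj : lker (cube_map g) == 0%VS.
  by apply/eqP; case: cube_act_orthogonal.
rewrite -cube_mapE; apply/idP/idP=> [|/memv_img->//].
by case/memv_imgP=> w Sw /inj->.
Qed.

Lemma cube_map_lagrangian S :
  lagrangian q3 S -> lagrangian q3 (cube_map g @: S).
Proof.
case=> S0 perpS; have og3 := cube_act_orthogonal; split.
  by move=> _ /memv_imgP[v /S0 Sv ->]; case: og3 => _ ->.
move=> v; rewrite -(cube_actVK v) cube_map_mem => perpv; apply: perpS => w Sw.
rewrite -(orthogonal_polar _ _ og3) cube_mapE; apply: perpv.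
by rewrite cube_mapE cube_map_mem.
Qed.

End Action.

Lemma cube_conjugate_sym A A' : cube_conjugate q A A' -> cube_conjugate q A' A.
Proof.
case=> g [og AA']; exists (fun i => (g i)^-1%VF); split=> [i|v].
  by case: (orthogonal_inv q_quad q_ns (og i)).
by rewrite AA' cube_actVK.
Qed.

Lemma cube_conjugate_trans A A' A'' :
  cube_conjugate q A A' -> cube_conjugate q A' A'' -> cube_conjugate q A A''.
Proof.
case=> g [og AA'] [h [oh AA'']].
exists (fun i => (h i \o g i)%VF); split=> [i|v].
  have hgq x : q ((h i \o g i)%VF x) = q x.
    by rewrite lfunE /=; case: (oh i) => _ ->; case: (og i) => _ ->.
  split=> //; exact: (polar_preserved_injective q_quad q_ns).
rewrite AA' AA''.
suff -> : cube_act h (cube_act g v) = cube_act (fun i => (h i \o g i)%VF) v.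
  by [].
by apply/ffunP=> i; rewrite !ffunE lfunE.
Qed.

Lemma cube_code_act (g : 'End(R)) (Phi Psi Phi' Psi' : {vspace R}) v :
  (forall x, x \in Phi -> g x \in Phi') ->
  (forall x, x \in Psi -> g x \in Psi') ->
  cube_code Phi Psi v -> cube_code Phi' Psi' (cube_act (fun=> g) v).
Proof.
move=> gPhi gPsi [a [b [Pa Pb sa ->]]]; exists (g \o a), (g b); split=> [i|||].
- exact: gPhi.
- exact: gPsi.
- rewrite -linear_sum; move: sa => /memv_capP[sPhi sPsi].
  by rewrite memv_cap gPhi ?gPsi.
by apply/ffunP=> i; rewrite !ffunE linearD.
Qed.

(** One isometry carrying the first pair to the second acts on all three coordinates; its inverse
    gives the reverse inclusion. *)
Lemma cube_code_conjugate Phi Psi Phi' Psi' :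
  lagrangian q Phi -> lagrangian q Psi -> (Phi :&: Psi)%VS = 0%VS ->
  lagrangian q Phi' -> lagrangian q Psi' -> (Phi' :&: Psi')%VS = 0%VS ->
  cube_conjugate q (cube_code Phi Psi) (cube_code Phi' Psi').
Proof.
move=> lagPhi lagPsi cap0 lagPhi' lagPsi' cap0'.
have [g [og gPhi gPsi]] :=
  lagrangian_pair_transport q_quad q_ns lagPhi lagPsi cap0
    lagPhi' lagPsi' cap0'.
have [_ [gVK gK]] := orthogonal_inv q_quad q_ns og.
exists (fun=> g); split=> // v; split.
  by apply: cube_code_act => x; rewrite ?gPhi ?gPsi.
move/(@cube_code_act g^-1%VF _ _ Phi Psi).
have -> : cube_act (fun=> g^-1%VF) (cube_act (fun=> g) v) = v.
  by apply/ffunP=> i; rewrite !ffunE gK.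
by apply=> x; rewrite ?gPhi ?gPsi gVK.
Qed.

Lemma weight4_conjugate_code S :
  lagrangian q3 S ->
  (forall v, v \in S -> v != 0 -> (4 <= cube_weight q v)%N) ->
  exists Phi Psi, [/\ lagrangian q Phi, lagrangian q Psi,
      (Phi :&: Psi)%VS = 0%VS
    & cube_conjugate q (fun v => v \in S) (cube_code Phi Psi)].
Proof.
move=> lagS weightS.
have [g1 [og1 g1P]] := @face_isometry S lagS weightS i1 i2 isT isT isT.
have [g2 [og2 g2P]] := @face_isometry S lagS weightS i2 i1 isT isT isT.
(* The first coordinate stays fixed and the other two are aligned with it: [g1] through vectors with
   last entry zero, [g2] through those with middle entry zero. *)
pose g (i : 'I_3) : 'End(R) :=
  if i == i0 then \1%VF else if i == i1 then g1 else g2.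
have og : forall i, orthogonal q (g i).
  elim/ord3_forall=> //; split=> [|x]; last by rewrite lfunE.
  by apply/eqP/lker0P=> x y; rewrite !lfunE.
have gE v : cube_act g v = triple (v i0) (g1 (v i1)) (g2 (v i2)).
  by apply/ffunP; elim/ord3_forall; rewrite !ffunE //= lfunE.
pose Phi := face S i0 i2; pose T := (cube_map g @: S)%VS.
have lagPhi : lagrangian q Phi by apply: face_lagrangian.
have T_aa0 a : a \in Phi -> triple a a 0 \in T.
  case/memv_imgP=> v Kv ->; rewrite coordinateE -{2}(g1P v Kv).
  have /zero_sectionP[Sv v2] := Kv.
  by rewrite -(linear0 g2) -v2 -gE cube_map_mem.
have T_a0a a : a \in Phi -> triple a 0 a \in T.
  (* The first-coordinate face is the same whichever other entry vanishes, so one [Phi] serves both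
     alignments. *)
  rewrite /Phi -(@face_eq S lagS weightS i0 i1 i2) //.
  case/memv_imgP=> v Kv ->; rewrite coordinateE -{2}(g2P v Kv).
  have /zero_sectionP[Sv v1] := Kv.
  by rewrite -(linear0 g1) -v1 -gE cube_map_mem.
have T_a00 a : triple a 0 0 \in T -> a = 0.
  case/memv_imgP=> v Sv; rewrite cube_mapE gE => /ffunP e.
  have z x h : orthogonal q h -> 0 = h x -> x = 0.
    case=> /eqP/lker0P inj _ e0; apply: inj; rewrite linear0.
    exact: esym.
  have v1 : v i1 = 0 by have := e i1; rewrite !ffunE /=; apply: z.
  have v2 : v i2 = 0 by have := e i2; rewrite !ffunE /=; apply: z.
  (* A preimage supported on the first coordinate is killed by the weight condition. *)
  have v0 : v = 0.
    by apply: (@zero_section_coord_inj S weightS i1 i2) => //; apply/zero_sectionP.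
  by have := e i0; rewrite !ffunE /= v0 ffunE.
have [Psi [lagPsi cap0 TE]] :=
  normal_form (cube_map_lagrangian og lagS) lagPhi T_aa0 T_a0a T_a00.
exists Phi, Psi; split=> //; exists g; split=> // v.
by rewrite -TE cube_map_mem.
Qed.

End Cube.

Theorem theorem2p8 (m : nat) (R : vectType 'F_2) (q : R -> 'F_2)
    (q_quad : quadratic_form q) (q_nonsing : non_singular q)
    (q_plus : plus_type q m) :
  (forall S : {vspace {ffun 'I_3 -> R}},
     max_singular_weight4 q S ->
     exists Phi Psi : {vspace R},
       [/\ max_totally_singular q Phi,
           max_totally_singular q Psi,
           (Phi :&: Psi)%VS = 0%VS
         & cube_conjugate q (fun v => v \in S) (cube_code Phi Psi)]) /\
  (forall S T : {vspace {ffun 'I_3 -> R}},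
     max_singular_weight4 q S -> max_singular_weight4 q T ->
     cube_conjugate q (fun v => v \in S) (fun v => v \in T)).
Proof.
have [dimR dim_max] := q_plus.
have [U maxU] := exists_max_totally_singular q_quad.
(* Plus type enters here: a maximal totally singular subspace has half the dimension of [R]. *)
have lagU : lagrangian q U.
  apply: (singular_half_lagrangian q_quad q_nonsing (proj1 maxU)).
  by rewrite dimR dim_max // mul2n -addnn.
have [W lagW] := cube_lagrangian q_quad lagU.
have code (S : {vspace {ffun 'I_3 -> R}}) : max_singular_weight4 q S ->
    exists Phi Psi, [/\ lagrangian q Phi, lagrangian q Psi,
      (Phi :&: Psi)%VS = 0%VS
      & cube_conjugate q (fun v => v \in S) (cube_code Phi Psi)].
  case=> maxS weightS; apply: weight4_conjugate_code => //.
  exact: (max_lagrangian (cube_quadratic q_quad)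
            (cube_non_singular q_quad q_nonsing) lagW maxS).
split=> [S /code[Phi [Psi [lagPhi lagPsi cap0 conj]]]|S T].
  by exists Phi, Psi; split=> //; apply: lagrangian_max.
move=> /code[Phi [Psi [lagPhi lagPsi cap0 conjS]]].
move=> /code[Phi' [Psi' [lagPhi' lagPsi' cap0' conjT]]].
(* The chain runs from [S] to its code, to the code of [T], and back to [T]. *)
apply: (cube_conjugate_trans q_quad q_nonsing conjS).
apply: (cube_conjugate_trans q_quad q_nonsing)
  (cube_conjugate_sym _ _ conjT) => //.
exact: cube_code_conjugate.
Qed.
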